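(* Let $C\subset\mathbb P^2$ be a plane curve of degree $d$ through $O$, smooth at $O$, and let $D\subset\mathbb P^2$ be a line. Then $\Delta_{C,s_+}=\Delta_{d,\frac sd,\frac1d}$ for every rational $s\ge d^2$. In particular, for such $s$, $$\Delta_{(C,O)}(D)=\Delta_{\frac1d,d}=\begin{pmatrix}0&1\\1&-s\end{pmatrix}\Delta_{C,s_+},$$ where the matrix acts on column vectors $(t,u)^T$.
   Context: Work over $\mathbb C$; $x=X/Z$, $y=Y/Z$, $O=(0,0)$; $C$ tangent to $\{y=0\}$ at $O$, locally $x\mapsto(x,\xi(x))$, $\xi\in\mathbb C[[x]]$, $\xi(0)=\xi'(0)=0$. For $f\ne0$ with $C$-expansion $f=\sum a_{ij}x^i(y-\xi(x))^j$, $v_1(C,s;f)=\min\{i+sj:a_{ij}\ne0\}$ and, for rational $s$, $v_+(C,s)(f)=(v_1(C,s;f),\min\{j:\exists i,\ a_{ij}\ne0,\ i+sj=v_1(C,s;f)\})$. $\Delta_{C,s_+}\subset\mathbb R^2$ (coordinates $(t,u)$) is the closure of the convex hull of $\{v_+(C,s)(F/Z^k)/k:k\ge1,\ F\ne0\text{ homogeneous of degree }k\}$. $\Delta_{(C,O)}(D)$ is the Newton–Okounkov body of the line class with respect to the flag $\mathbb P^2\supset C\supset O$, i.e. built in the same way from the flag valuation $\nu(\phi)=(\operatorname{ord}_C\phi,\operatorname{ord}_O((\phi/g^{\operatorname{ord}_C\phi})|_C))$, $g$ a local equation of $C$ at $O$. $\Delta_{a,b,c}$ is the triangle with vertices $(0,0),(a,0),(b,c)$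 and $\Delta_{a,c}=\Delta_{a,0,c}$. *)

(* Defs.v *)
From HB Require Import structures.
From mathcomp Require Import all_boot all_algebra.
From mathcomp Require Import mpoly.
From mathcomp Require Import complex.
From mathcomp Require Import Rstruct.

Set Implicit Arguments.
Unset Strict Implicit.
Unset Printing Implicit Defensive.
Import GRing.Theory Num.Theory.
Local Open Scope ring_scope.

Definition CC : numClosedFieldType := complex Rdefinitions.R.
Definition RR : rcfType := Rdefinitions.R.

Definition iX : 'I_3 := @Ordinal 3 0 isT.
Definition iY : 'I_3 := @Ordinal 3 1 isT.
Definition iZ : 'I_3 := @Ordinal 3 2 isT.

Definition ptO : 'I_3 -> CC := fun i => if i == iZ then 1 else 0.

Definition homog3 (k : nat) (F : {mpoly CC[3]}) : bool :=
  all (fun m : 'X_{1..3} => mdeg m == k) (msupp F).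

Definition mconst (A : {mpoly CC[3]}) : bool := (msize A <= 1)%N.

Definition mirreducible (G : {mpoly CC[3]}) : Prop :=
  ~~ mconst G /\ forall A B : {mpoly CC[3]}, G = A * B -> mconst A \/ mconst B.

(* Formal power series in x, as coefficient sequences. *)
Definition ps := nat -> CC.
Definition ps1 : ps := fun n => if n == 0%N then 1 else 0.
Definition psmul (a b : ps) : ps := fun n => \sum_(i < n.+1) a i * b (n - i)%N.
Definition psexp (a : ps) (n : nat) : ps := iter n (psmul a) ps1.

(* C-expansion: for F homogeneous (of any degree k), the coefficient a_ij in
   F/Z^k = F(x,y,1) = sum_{i,j} a_ij x^i (y - xi(x))^j.  Writing
   F = sum_m c_m X^m0 Y^m1 Z^m2, F/Z^k = sum_m c_m x^m0 ((y-xi) + xi)^m1, so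
   a_ij = sum_m c_m binom(m1,j) [x^(i-m0)] xi^(m1-j). *)
Definition expand (xi : ps) (F : {mpoly CC[3]}) (i j : nat) : CC :=
  \sum_(m <- msupp F)
     F@_m * ('C(m iY, j))%:R *
     (if (m iX <= i)%N then psexp xi (m iY - j) (i - m iX)%N else 0).

(* (i,j) realizes v_+(C,s)(F/Z^k): a_ij <> 0, i + s j is minimal among the
   nonzero coefficients and j is minimal among those achieving it.  Then
   v_+(C,s)(F/Z^k) = (i + s j, j). *)
Definition vplus_at (xi : ps) (s : rat) (F : {mpoly CC[3]}) (i j : nat) : Prop :=
  expand xi F i j != 0 /\
  forall i' j' : nat, expand xi F i' j' != 0 ->
    (i%:Q + s * j%:Q <= i'%:Q + s * j'%:Q) /\
    (i'%:Q + s * j'%:Q = i%:Q + s * j%:Q -> (j <= j')%N).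

Definition ps_ord (h : ps) (o : nat) : Prop :=
  h o != 0 /\ forall i, (i < o)%N -> h i = 0.

Definition set2 := RR * RR -> Prop.

Definition conv_hull (S : set2) : set2 := fun p =>
  exists (n : nat) (w : 'I_n -> RR) (q : 'I_n -> RR * RR),
    (forall i, 0 <= w i) /\ \sum_(i < n) w i = 1 /\ (forall i, S (q i)) /\
    p = (\sum_(i < n) w i * (q i).1, \sum_(i < n) w i * (q i).2).

Definition closure2 (S : set2) : set2 := fun p =>
  forall e : RR, 0 < e -> exists q, S q /\ `|p.1 - q.1| < e /\ `|p.2 - q.2| < e.

Definition seteq2 (A B : set2) : Prop := forall p, A p <-> B p.

Definition triangle (a b c : RR) : set2 :=
  conv_hull (fun p => p = (0, 0) \/ p = (a, 0) \/ p = (b, c)).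

Definition matimg (a b c e : RR) (S : set2) : set2 := fun p =>
  exists q, S q /\ p = (a * q.1 + b * q.2, c * q.1 + e * q.2).

Definition DeltaCs (xi : ps) (s : rat) : set2 :=
  closure2 (conv_hull (fun p =>
    exists (k : nat) (F : {mpoly CC[3]}) (i j : nat),
      (0 < k)%N /\ homog3 k F /\ F != 0 /\ vplus_at xi s F i j /\
      p = (ratr (i%:Q + s * j%:Q) / k%:R, j%:R / k%:R))).

(* Flag valuation nu(F/Z^k) = (ord_C, ord_O((F/Z^k / g^ord_C)|_C)) with C = {G = 0},
   local equation g = G/Z^d, O-order computed via the parametrization x |-> (x, xi x). *)
Definition nu_at (G : {mpoly CC[3]}) (xi : ps) (F : {mpoly CC[3]}) (m o : nat) : Prop :=
  exists H : {mpoly CC[3]},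
    F = G ^+ m * H /\ ~ (exists Q, H = G * Q) /\ ps_ord (fun i => expand xi H i 0) o.

(* Delta_{(C,O)}(D), D a line (class of O(1)). *)
Definition DeltaNO (G : {mpoly CC[3]}) (xi : ps) : set2 :=
  closure2 (conv_hull (fun p =>
    exists (k : nat) (F : {mpoly CC[3]}) (m o : nat),
      (0 < k)%N /\ homog3 k F /\ F != 0 /\ nu_at G xi F m o /\
      p = (m%:R / k%:R, o%:R / k%:R))).

(* Main.v *)
Require Import Defs.
From HB Require Import structures.
From mathcomp Require Import all_boot all_order all_algebra.
From mathcomp Require Import mpoly.
From mathcomp Require Import complex.
From mathcomp Require Import Rstruct.
From mathcomp Require Import ring lra zify.
From Stdlib Require Import Classical.
Set Implicit Arguments.
Unset Strict Implicit.
Unset Printing Implicit Defensive.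
Import Order.TTheory GRing.Theory Num.Theory.
Local Open Scope ring_scope.

(** Let [F] be a form of degree [k] and write [F = G ^+ m * H] with [G] not
    dividing [H].  Bezout bounds the order [o] of [H] along [C] at [O] by
    [d * (k - d * m)], and the coefficient of index [(o, m)] in the
    [C]-expansion of [F] is the first nonzero one in its row, all rows below [m]
    being zero.  Hence for [s >= d ^ 2] both [(o, m)] and the index realizing
    [v_+(C, s)] lie in [A k = {(i, j) | i + d ^ 2 * j <= d * k}], which is the
    claimed triangle in other coordinates.  The vertices given by [Z] and [G]
    are attained.  For the third one, [A k] has only [O(k)] more points than the
    dimension of the space of forms, so a nonzero form can be made to vanish at
    all indices of [A k] outside a small neighbourhood of [(d * k, 0)]; its
    valuation is then in that neighbourhood.

    The local form of Bezout also comes from a dimension count: if [H] vanished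
    along [C] to order [> d * e], then the forms [A * G + B * H] and
    [X ^+ i * Z ^+ (n - i)], [i <= d * e], would span too much.  The only
    arithmetic input is that [G] is prime, i.e. Gauss' lemma over [C[x]], which
    is easy because nonconstant contents have linear factors. *)

(** * Irreducible bivariate polynomials are prime *)

Section Gauss.
Variable K : closedFieldType.
Implicit Types (f g h q : {poly {poly K}}) (c : {poly K}).

(** Over a closed field a nonconstant content has a root [a], and setting x = a then kills [f]; so
    this says that [f] is nonzero with unit content. *)
Definition primitive_in_x f := forall a : K, map_poly (horner_eval a) f != 0.

Lemma map_horner_eq0 f a : map_poly (horner_eval a) f = 0 ->
  exists f', f = ('X - a%:P) *: f'.
Proof.
move=> f0; exists (map_poly (fun c => c %/ ('X - a%:P)) f).
apply/polyP => j; rewrite coefZ coef_map_id0 ?div0p // mulrC divpK //.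
have := congr1 (fun p : {poly K} => p`_j) f0.
by rewrite coef_map coef0 /= /horner_eval => fj; rewrite dvdp_XsubCl rootE fj.
Qed.

(** Each linear factor pulled out of [f] lowers the degree of its leading coefficient, so the
    extraction stops. *)
Lemma primitive_factor f : f != 0 ->
  exists c f', [/\ c != 0, f = c *: f' & primitive_in_x f'].
Proof.
have [n] := ubnP (size (lead_coef f)); elim: n f => // n IHn f szf nzf.
have [prim|nprim] := classic (primitive_in_x f).
  by exists 1, f; rewrite oner_neq0 scale1r.
have [a /negP/negPn/eqP/map_horner_eq0[f1 fE]] := not_all_ex_not _ _ nprim.
have nzX : 'X - a%:P != 0 :> {poly K} by rewrite polyXsubC_eq0.
have nzf1 : f1 != 0 by apply: contraNneq nzf => f10; rewrite fE f10 scaler0.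
have lt_f1 : (size (lead_coef f1) < n)%N.
  move: szf; rewrite fE lead_coefZ size_mul ?lead_coef_eq0 // size_XsubC.
  by rewrite add2n /= ltnS.
have [c [f' [nzc f1E prim']]] := IHn _ lt_f1 nzf1.
exists (('X - a%:P) * c), f'; split; [by rewrite mulf_neq0| |by []].
by rewrite fE f1E scalerA.
Qed.

(** Gauss' lemma, one root of [c] at a time: at x = a the left side vanishes while [f] does not, so
    x - a divides [q] and can be cancelled. *)
Lemma dvd_of_scale_primitive c f h q : primitive_in_x f -> c != 0 ->
  c *: h = q * f -> exists q', h = q' * f.
Proof.
move=> primf; have [n] := ubnP (size c).
elim: n c q => // n IHn c q szc nzc chqf.
have [sz1|sz1] := eqVneq (size c) 1.
  have /size_poly1P[u nzu cu] : size c == 1 by rewrite sz1.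
  exists (u^-1%:P *: q); rewrite -scalerAl -chqf cu scalerA -polyCM.
  by rewrite mulVf // scale1r.
have /closed_rootP[a ra] := sz1.
move: ra; rewrite -dvdp_XsubCl => /dvdpP[c' cE].
have nzX : 'X - a%:P != 0 :> {poly K} by rewrite polyXsubC_eq0.
have nzc' : c' != 0 by apply: contraNneq nzc => c'0; rewrite cE c'0 mul0r.
have qa0 : map_poly (horner_eval a) q = 0.
  have /eqP := congr1 (map_poly (horner_eval a)) chqf.
  rewrite rmorphM /= map_polyZ cE /= [horner_eval a _]hornerM hornerXsubC subrr.
  by rewrite mulr0 scale0r eq_sym mulf_eq0 (negPf (primf a)) orbF => /eqP.
have [q' qE] := map_horner_eq0 qa0.
apply: (IHn c' q') => //.
  by move: szc; rewrite cE size_mul // size_XsubC addn2 /= ltnS.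
have nzXC : ('X - a%:P)%:P != 0 :> {poly {poly K}} by rewrite polyC_eq0.
by apply: (mulfI nzXC); rewrite !mul_polyC scalerA mulrC -cE chqf qE -scalerAl.
Qed.


Definition bivar_const f := (size f <= 1)%N && (size (f`_0)%R <= 1)%N.

(** The primitive part [D] of [gcdp g h] divides [g] and [h] by Gauss' lemma, and in g = q1 D one
    factor is constant. If it is [q1], then [g] divides [h]. If it is [D], then [g] and [h] are
    coprime over K(x), and a Bezout relation times [b] makes [g] divide a K[x]-multiple of [b]. *)
Lemma irreducible_bivar_prime g a b h : (1 < size g)%N ->
    (forall p q, g = p * q -> bivar_const p \/ bivar_const q) ->
    a * g = b * h ->
  (exists q, b = q * g) \/ (exists q, h = q * g).
Proof.
move=> szg irr agbh.
have nzg : g != 0 by rewrite -size_poly_gt0 ltnW.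
have constE p : bivar_const p -> p != 0 -> exists2 u : K, u != 0 & p = u%:P%:P.
  case/andP=> sz1 sz2 nzp; exists p`_0`_0.
    by apply: contraNneq nzp => p0; rewrite (size1_polyC sz1) (size1_polyC sz2) p0.
  by rewrite {1}(size1_polyC sz1) {1}(size1_polyC sz2).
have nzD : gcdp g h != 0 by rewrite gcdp_eq0 (negPf nzg).
have [e [D [nze DE primD]]] := primitive_factor nzD.
have dvdD p : gcdp g h %| p -> exists q, p = q * D.
  case/Pdiv.Idomain.dvdpP=> -[c q] /= nzc cp.
  apply: (dvd_of_scale_primitive (q := e *: q) primD nzc).
  by rewrite cp DE -scalerAr -scalerAl.
have [q1 gE] := dvdD _ (dvdp_gcdl g h); have [q2 hE] := dvdD _ (dvdp_gcdr g h).
have nzq1 : q1 != 0 by apply: contraNneq nzg => z; rewrite gE z mul0r.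
have nzDD : D != 0 by apply: contraNneq nzg => z; rewrite gE z mulr0.
have [/constE/(_ nzq1)[u nzu q1E]|/constE/(_ nzDD)[u nzu DuE]] := irr _ _ gE.
  right; exists (q2 * u^-1%:P%:P).
  by rewrite gE q1E -mulrA [_ * (_ * D)]mulrA -!polyCM mulVf // mul1r.
have /Bezout_coprimepP[[v w] /= /eqpP[[c1 c2] /= /andP[nzc1 nzc2]]] : coprimep g h.
  by rewrite coprimep_def DE DuE -mul_polyC -polyCM size_polyC mulf_neq0 // polyC_eq0.
move=> bez; left.
have [c [g' [nzc g'E primg]]] := primitive_factor nzg.
(* A constant [g'] would contradict [1 < size g]. So the content [c] is constant, and it is enough
   to divide by the primitive [g']. *)
have [cst|cst] : bivar_const c%:P \/ bivar_const g' by apply: irr; rewrite g'E mul_polyC.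
  have [|y nzy /polyC_inj cy] := constE _ cst; first by rewrite polyC_eq0.
  suff [q bE] : exists q, b = q * g'.
    exists (q * y^-1%:P%:P); rewrite bE g'E cy -mul_polyC -mulrA.
    by rewrite [_ * (_ * g')]mulrA -!polyCM mulVf // mul1r.
  apply: (dvd_of_scale_primitive (c := c2)
            (q := c1%:P * (v * b + w * a) * c%:P) primg nzc2).
  have -> : c2 *: b = b * (c2 *: 1) by rewrite -scalerAr mulr1.
  rewrite -bez -mul_polyC -[c1%:P * _ * _ * g']mulrA [c%:P * g']mul_polyC -g'E.
  transitivity (c1%:P * (v * b * g + w * (b * h))); first by ring.
  by rewrite -agbh; ring.
by case/andP: cst => sz1 _; move: szg; rewrite g'E size_scale // ltnNge sz1.
Qed.

End Gauss.

(** * Dehomogenization and the [C]-expansion *)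

Local Notation bipoly := {poly {poly CC}}.

(** The inner variable is x and the outer one stands for y - f(x), so outer degree j and inner
    degree i belong to x^i (y - f)^j. With [f = 0] this is plain dehomogenization. *)
Definition chart (f : {poly CC}) (i : 'I_3) : bipoly :=
  if i == iX then 'X%:P else if i == iY then 'X + f%:P else 1.

Definition dehom (f : {poly CC}) : {mpoly CC[3]} -> bipoly :=
  mmap (polyC \o polyC) (chart f).

HB.instance Definition _ f := GRing.RMorphism.copy (dehom f)
  (mmap ((@polyC {poly CC}) \o (@polyC CC)) (chart f)).

Lemma chart_mmap1 f (m : 'X_{1..3}) :
  mmap1 (chart f) m = 'X^(m iX)%:P * ('X + f%:P) ^+ m iY.
Proof.
rewrite /mmap1 !big_ord_recl big_ord0 mulr1.
have -> : @ord0 2 = iX by apply: val_inj.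
have -> : lift iX (@ord0 1) = iY by apply: val_inj.
have -> : lift iX (lift (@ord0 1) (@ord0 0)) = iZ by apply: val_inj.
by rewrite /chart /= expr1n mulr1 polyC_exp.
Qed.

Lemma coef_XaddC_exp (R : comNzRingType) (c : R) n j :
  (('X + c%:P) ^+ n)`_j = c ^+ (n - j) *+ 'C(n, j).
Proof.
rewrite exprDn coef_sum.
under eq_bigr => i _ do rewrite coefMn mulrC -polyC_exp coefCM coefXn.
case: (leqP j n) => [lejn|ltnj]; last first.
  rewrite bin_small // mulr0n big1 // => i _.
  by rewrite (_ : (j == _) = false) ?mulr0 ?mul0rn //; apply/negbTE; lia.
have jn : (n - j < n.+1)%N by lia.
rewrite (bigD1 (Ordinal jn)) //= subKn // eqxx mulr1 bin_sub // big1 ?addr0 //.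
move=> i; rewrite -val_eqE /= => ni.
by rewrite (_ : (j == _) = false) ?mulr0 ?mul0rn //; apply/negbTE; have := ltn_ord i; lia.
Qed.

Lemma coef_dehom f F i j : (dehom f F)`_j`_i =
  \sum_(m <- msupp F) F@_m * ('C(m iY, j))%:R *
     (if (m iX <= i)%N then (f ^+ (m iY - j))`_(i - m iX) else 0).
Proof.
rewrite /dehom /mmap !coef_sum; apply: eq_bigr => m _.
rewrite chart_mmap1 /= coefCM coefCM coefCM coef_XaddC_exp -mulrA; congr (_ * _).
rewrite mulrnAr coefMn coefXnM mulr_natl ltnNge.
by case: (m iX <= i)%N => //=; rewrite mul0rn.
Qed.

Definition ps_trunc (N : nat) (xi : ps) : {poly CC} := \poly_(i < N) xi i.

Lemma psexp_trunc xi N n i : (i < N)%N -> psexp xi n i = (ps_trunc N xi ^+ n)`_i.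
Proof.
elim: n i => [|n IHn] i ltiN; first by rewrite expr0 coef1 /psexp /= /ps1; case: eqP.
rewrite exprS coefM /psexp iterS /psmul; apply: eq_bigr => a _.
have ltaN : (a < N)%N by have := ltn_ord a; lia.
by rewrite coef_poly ltaN; congr (_ * _); apply: IHn; lia.
Qed.

(** Coefficients up to x^i see only the first i + 1 terms of [xi], so a truncation suffices, and the
    algebra of [expand] follows from [dehom] being a ring morphism. *)
Lemma expand_dehom xi N F i j : (i < N)%N ->
  expand xi F i j = (dehom (ps_trunc N xi) F)`_j`_i.
Proof.
move=> ltiN; rewrite coef_dehom; apply: eq_bigr => m _; congr (_ * _).
by case: ifP => // _; apply: psexp_trunc; lia.
Qed.

Lemma expandM xi F H i j : expand xi (F * H) i j =
  \sum_(b < j.+1) \sum_(a < i.+1) expand xi F a b * expand xi H (i - a) (j - b).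
Proof.
rewrite (@expand_dehom _ i.+1) // rmorphM coefM coef_sum.
apply: eq_bigr => b _; rewrite coefM; apply: eq_bigr => a _.
by rewrite -!(@expand_dehom _ i.+1) //; have := ltn_ord a; lia.
Qed.

Lemma dehomZ f c F : dehom f (c *: F) = c%:P%:P * dehom f F.
Proof. by rewrite /dehom mmapZ. Qed.

Lemma dehomC f c : dehom f c%:MP = c%:P%:P.
Proof. by rewrite /dehom mmapC. Qed.

Lemma dehomX f i : dehom f 'X_i = chart f i.
Proof. by rewrite /dehom mmapX mmap1U. Qed.

Lemma expandP xi c F H i j :
  expand xi (c *: F + H) i j = c * expand xi F i j + expand xi H i j.
Proof.
by rewrite !(@expand_dehom _ i.+1) // rmorphD /= dehomZ !coefD !coefCM.
Qed.

Lemma expand0 xi i j : expand xi 0 i j = 0.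
Proof. by rewrite /expand msupp0 big_nil. Qed.

Lemma expandD xi F H i j : expand xi (F + H) i j = expand xi F i j + expand xi H i j.
Proof. by rewrite -[F]scale1r expandP mul1r scale1r. Qed.

Lemma expandZ xi c F i j : expand xi (c *: F) i j = c * expand xi F i j.
Proof. by rewrite -[c *: F]addr0 expandP expand0 addr0. Qed.

Lemma expand_sum xi (I : Type) (r : seq I) (P : pred I) (F : I -> {mpoly CC[3]}) i j :
  expand xi (\sum_(a <- r | P a) F a) i j = \sum_(a <- r | P a) expand xi (F a) i j.
Proof.
by apply: (big_morph (fun F => expand xi F i j)) => [A B|]; rewrite ?expandD ?expand0.
Qed.

Lemma expand_XZ xi a b i : expand xi ('X_iX ^+ a * 'X_iZ ^+ b) i 0 = (i == a)%:R.
Proof.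
rewrite (@expand_dehom _ i.+1) // rmorphM !rmorphXn /= !dehomX /chart /= expr1n.
by rewrite mulr1 -polyC_exp coefC eqxx coefXn.
Qed.

Lemma expand1 xi i : expand xi 1 i 0 = (i == 0%N)%:R.
Proof. by have := expand_XZ xi 0 0 i; rewrite !expr0 mulr1. Qed.

(** Since f(0) = 0, the curve y = f(x) passes through [O], and the linear coefficient in y - f at x
    = 0 is the Y-derivative there. *)
Lemma coef10_dehom (f : {poly CC}) F : f`_0 = 0 ->
  (dehom f F)`_1`_0 = (mderiv iY F).@[ptO].
Proof.
move=> f0; rewrite coef_dehom [mderiv iY F]/mderiv raddf_sum /=; apply: eq_bigr => m _.
rewrite mevalZ mevalX bin1 [_ * F@_m]mulrC; congr (_ * _).
rewrite !big_ord_recl big_ord0 mulr1.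
have -> : @ord0 2 = iX by apply: val_inj.
have -> : lift iX (@ord0 1) = iY by apply: val_inj.
have -> : lift iX (lift (@ord0 1) (@ord0 0)) = iZ by apply: val_inj.
rewrite !mnmBE !mnm1E /ptO /= expr1n mulr1 subn0 leqn0.
have coef0X n : (f ^+ n)`_0 = 0 ^+ n.
  by rewrite -!horner_coef0 horner_exp !horner_coef0 f0.
by case: (m iX) => [|n] /=; rewrite ?coef0X ?expr0 ?mul1r // exprS !mul0r.
Qed.

Lemma dehom0_coef (F : {mpoly CC[3]}) i j : (dehom 0 F)`_j`_i =
  \sum_(m <- msupp F | (m iX == i) && (m iY == j)) F@_m.
Proof.
rewrite coef_dehom [RHS]big_mkcond; apply: eq_bigr => m _ /=; rewrite expr0n subn_eq0.
case: (ltngtP (m iX) i) => /= [mi||->]; last 2 first.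
- by rewrite mulr0.
- rewrite subnn; case: (ltngtP (m iY) j) => /= [lt|gt|->].
  + by rewrite bin_small // mulr0 mul0r.
  + by rewrite coef0 mulr0.
  + by rewrite binn coef1 eqxx !mulr1.
by case: leqP => _; rewrite ?coef0 ?mulr0 // coef1 subn_eq0 leqNgt mi mulr0.
Qed.

Lemma mdeg3 (m : 'X_{1..3}) : mdeg m = (m iX + m iY + m iZ)%N.
Proof.
rewrite mdegE !big_ord_recl big_ord0 addn0 addnA.
by congr (m _ + m _ + m _)%N; apply: val_inj.
Qed.

Lemma mnm3_eq (m m' : 'X_{1..3}) :
  mdeg m = mdeg m' -> m iX = m' iX -> m iY = m' iY -> m = m'.
Proof.
rewrite !mdeg3 => E EX EY; apply/mnmP => -[[|[|[|//]]] lt].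
- by rewrite (_ : Ordinal _ = iX) //; apply: val_inj.
- by rewrite (_ : Ordinal _ = iY) //; apply: val_inj.
- by rewrite (_ : Ordinal _ = iZ) //; [lia|apply: val_inj].
Qed.

(** In a fixed degree the exponents of X and Y determine that of Z. *)
Lemma dehom0_inj n : {in n.-homog &, injective (dehom 0)}.
Proof.
move=> F F' hF hF' /eqP; rewrite -subr_eq0 -rmorphB /= => /eqP E.
have hD : F - F' \is n.-homog by rewrite rpredB.
apply/eqP; rewrite -subr_eq0; apply/eqP/mpolyP => m; rewrite mcoeff0.
have [min|] := boolP (m \in msupp (F - F')); last exact: memN_msupp_eq0.
have := congr1 (fun p : bipoly => p`_(m iY)`_(m iX)) E.
rewrite dehom0_coef !coef0 big_mkcond (bigD1_seq m) ?msupp_uniq //= !eqxx /=.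
rewrite big_seq_cond big1 ?addr0 // => m' /andP[m'in /eqP m'm].
case: ifP => // /andP[/eqP EX /eqP EY]; case: m'm; apply: mnm3_eq => //.
by rewrite (dhomog_mf hD m'in) (dhomog_mf hD min).
Qed.

(** * Total degree and homogenization *)

Definition tdeg_le (n : nat) (p : bipoly) := forall i j, (n < i + j)%N -> p`_j`_i = 0.

Lemma dehom0_tdeg n F : F \is n.-homog -> tdeg_le n (dehom 0 F).
Proof.
move=> hF i j lt; rewrite dehom0_coef big_seq_cond big1 // => m.
case/andP=> min /andP[/eqP EX /eqP EY]; move: lt; rewrite -EX -EY.
by have <- : mdeg m = n := dhomog_mf hF min; rewrite mdeg3; lia.
Qed.

(** Terms of total degree above [n] are lost, hence the [tdeg_le] hypothesis in [homogenizeK]. *)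
Definition homogenize (n : nat) (p : bipoly) : {mpoly CC[3]} :=
  \sum_(j < n.+1) \sum_(i < (n - j).+1)
    p`_j`_i *: ('X_iX ^+ i * 'X_iY ^+ j * 'X_iZ ^+ (n - j - i)).

Lemma dhomog_var i : ('X_i : {mpoly CC[3]}) \is 1.-homog.
Proof. by rewrite dhomogX; apply/eqP/mdeg1. Qed.

Lemma homogenize_homog n p : homogenize n p \is n.-homog.
Proof.
apply: rpred_sum => j _; apply: rpred_sum => i _; apply: dhomogZ.
have En : (1 * i + 1 * j + 1 * (n - j - i) = n)%N.
  by have := ltn_ord i; have := ltn_ord j; lia.
have := dhomogM (dhomogM (dhomogMn i (dhomog_var iX)) (dhomogMn j (dhomog_var iY)))
  (dhomogMn (n - j - i) (dhomog_var iZ)).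
by rewrite En.
Qed.

Lemma homogenizeK n p : tdeg_le n p -> dehom 0 (homogenize n p) = p.
Proof.
move=> pn; rewrite /homogenize rmorph_sum /=.
under eq_bigr => j _.
  rewrite rmorph_sum /=.
  under eq_bigr => i _.
    rewrite dehomZ !rmorphM !rmorphXn /= !dehomX /chart /= expr1n mulr1 addr0 mulrA.
    rewrite -polyC_exp -polyCM; over.
  rewrite -mulr_suml -rmorph_sum /=.
  over.
apply/polyP => b; rewrite coef_sum; apply/polyP => a.
under eq_bigr => j _ do rewrite coefCM coefXn.
have [ltbn|ltnb] := ltnP b n.+1; last first.
  rewrite pn; last by lia.
  rewrite big1 ?coef0 // => j _; rewrite (_ : (b == j :> nat) = false) ?mulr0 //.
  by apply/negbTE; have := ltn_ord j; lia.
rewrite (bigD1 (Ordinal ltbn)) //= eqxx mulr1 [X in _ + X]big1 ?addr0; last first.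
  by move=> j; rewrite -val_eqE /= eq_sym => /negPf ->; rewrite mulr0.
rewrite coef_sum; under eq_bigr => i _ do rewrite coefCM coefXn.
have [ltan|ltna] := ltnP a (n - b).+1; last first.
  rewrite pn; last by lia.
  rewrite big1 // => i _; rewrite (_ : (a == i :> nat) = false) ?mulr0 //.
  by apply/negbTE; have := ltn_ord i; lia.
rewrite (bigD1 (Ordinal ltan)) //= eqxx mulr1 big1 ?addr0 //.
by move=> i; rewrite -val_eqE /= eq_sym => /negPf ->; rewrite mulr0.
Qed.

(** * Irreducible forms are prime *)

(* The substitution x -> x t, y -> t turns the total degree into the degree in t. *)
Definition grade_x : {poly CC} -> bipoly :=
  comp_poly ('X%:P * 'X) \o map_poly polyC.
Definition grade (p : bipoly) : bipoly := (map_poly grade_x p).['X].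

HB.instance Definition _ := GRing.RMorphism.copy grade_x
  (comp_poly (('X : {poly CC})%:P * 'X) \o map_poly polyC).

Lemma gradeM p q : grade (p * q) = grade p * grade q.
Proof. by rewrite /grade rmorphM hornerM. Qed.

Lemma coef_grade_x c n : (grade_x c)`_n = c`_n *: 'X^n.
Proof.
rewrite /grade_x /= comp_polyE coef_sum.
under eq_bigr => i _.
  rewrite coefZ exprMn -polyC_exp coefCM coefXn coef_map /= mulrA; over.
have [ltn|len] := ltnP n (size (map_poly polyC c)).
  rewrite (bigD1 (Ordinal ltn)) //= eqxx mulr1 -mul_polyC big1 ?addr0 //.
  by move=> i; rewrite -val_eqE /= eq_sym => /negPf ->; rewrite mulr0.
rewrite big1 => [|i _]; last first.
  by rewrite (_ : (n == i) = false) ?mulr0 //; apply/negbTE; have := ltn_ord i; lia.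
by rewrite nth_default ?scale0r // -(size_map_inj_poly (@polyC_inj CC)).
Qed.

Lemma coef_grade p n i :
  (grade p)`_n`_i = if (i <= n)%N then p`_(n - i)`_i else 0.
Proof.
(* The summation range is widened beyond [size p] so that the index [n - i] always lies in it. *)
rewrite /grade (@horner_coef_wide _ (n.+1 + size p)%N); last first.
  by rewrite (leq_trans (size_poly _ _)) // leq_addl.
rewrite !coef_sum.
under eq_bigr => j _.
  rewrite coefMXn coef_map /= coef_grade_x.
  over.
case: leqP => [lein|ltni].
  have ltj : (n - i < n.+1 + size p)%N by lia.
  rewrite (bigD1 (Ordinal ltj)) //= ltnNge leq_subr /= subKn // coefZ coefXn eqxx mulr1.
  rewrite big1 ?addr0 // => j; rewrite -val_eqE /= => ne.
  case: ltnP => [|lejn]; rewrite ?coef0 // coefZ coefXn.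
  by rewrite (_ : (i == _) = false) ?mulr0 //; apply/negbTE; lia.
rewrite big1 // => j _; case: ltnP => [|lejn]; rewrite ?coef0 // coefZ coefXn.
by rewrite (_ : (i == _) = false) ?mulr0 //; apply/negbTE; lia.
Qed.

Lemma tdeg_leP n p : tdeg_le n p <-> (size (grade p) <= n.+1)%N.
Proof.
split=> [pn|szp i j lt].
  apply/leq_sizeP => k ltk; apply/polyP => i; rewrite coef_grade coef0.
  by case: leqP => // leik; rewrite pn // subnKC.
have := coef_grade p (i + j) i; rewrite leq_addr addKn => <-.
by rewrite [(grade p)`_(i + j)]nth_default ?coef0 // (leq_trans szp).
Qed.

Lemma grade_neq0 p : p != 0 -> grade p != 0.
Proof.
apply: contraNneq => p0; apply/eqP/polyP => j; apply/polyP => i.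
by have := coef_grade p (i + j) i; rewrite leq_addr addKn p0 !coef0.
Qed.

(** [grade] turns the total degree into the degree in t, which is additive over a domain; [a] is the
    total degree of [p]. *)
Lemma tdeg_le_factor n p q : p != 0 -> q != 0 -> tdeg_le n (p * q) ->
  exists a, [/\ (a <= n)%N, tdeg_le a p & tdeg_le (n - a) q].
Proof.
move=> nzp nzq /tdeg_leP; have nzgp := grade_neq0 nzp; have nzgq := grade_neq0 nzq.
rewrite gradeM size_mul //.
have arith x y : (0 < x)%N -> (0 < y)%N -> ((x + y).-1 <= n.+1)%N ->
    [/\ x.-1 <= n, x <= x.-1.+1 & y <= (n - x.-1).+1]%N by move=> *; split; lia.
rewrite -size_poly_gt0 in nzgp; rewrite -size_poly_gt0 in nzgq.
case/(arith _ _ nzgp nzgq) => le1 le2 le3.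
by exists (size (grade p)).-1; split=> //; apply/tdeg_leP.
Qed.

(** The bounds on the total degrees add up to [n], so the homogenized factors multiply to a form of
    degree [n], which is [F] by injectivity. *)
Lemma homog_lift_factor n F p q : F \is n.-homog -> F != 0 -> dehom 0 F = p * q ->
  exists e P Q, [/\ (e <= n)%N /\ F = P * Q, P \is e.-homog, Q \is (n - e).-homog,
    dehom 0 P = p & dehom 0 Q = q].
Proof.
move=> hF nzF EF.
have : dehom 0 F != 0.
  apply: contraNneq nzF => E; apply/eqP.
  by apply: (dehom0_inj hF); rewrite ?rpred0 // E rmorph0.
rewrite EF mulf_eq0 negb_or => /andP[nzp nzq].
have := dehom0_tdeg hF; rewrite EF => /(tdeg_le_factor nzp nzq)[a [lean tp tq]].
exists a, (homogenize a p), (homogenize (n - a) q).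
split; try exact: homogenize_homog; try exact: homogenizeK; split=> //.
apply: (dehom0_inj hF); last by rewrite rmorphM /= !homogenizeK.
have := dhomogM (homogenize_homog a p) (homogenize_homog (n - a) q).
by rewrite subnKC.
Qed.

Section Prime.
Variables (d : nat) (G : {mpoly CC[3]}).
Hypotheses (hG : G \is d.-homog) (irrG : mirreducible G) (GO : G.@[ptO] = 0)
  (dGO : (mderiv iY G).@[ptO] != 0).

Lemma irreducible_neq0 : G != 0.
Proof. by apply: contraNneq dGO => ->; rewrite mderiv0 meval0. Qed.

Lemma dehom_irreducible p q : dehom 0 G = p * q -> bivar_const p \/ bivar_const q.
Proof.
move=> /(homog_lift_factor hG irreducible_neq0)[a [P [Q [[_ GE] _ _ <- <-]]]].
have cst A : mconst A -> bivar_const (dehom 0 A).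
  move=> /msize1_polyC ->; rewrite dehomC /bivar_const coefC eqxx.
  by rewrite !size_polyC !leq_b1.
by case: irrG => _ /(_ _ _ GE) [/cst|/cst]; [left|right].
Qed.

Lemma varZ_ptO n : ('X_iZ ^+ n : {mpoly CC[3]}).@[ptO] = 1.
Proof. by rewrite rmorphXn /= mevalXU /ptO eqxx expr1n. Qed.

(** A lift [P] of the dehomogenized [G] differs from [G] by a power of Z. If [P] had degree below
    [d], then Z would divide [G], which irreducibility and vanishing at [O] exclude. *)
Lemma dvd_of_dehom n F q : F \is n.-homog -> dehom 0 F = q * dehom 0 G ->
  exists Q, F = G * Q.
Proof.
move=> hF EF; have [->|nzF] := eqVneq F 0; first by exists 0; rewrite mulr0.
rewrite mulrC in EF.
have [a [P [Q [[lean FE] hP hQ EP EQ]]]] := homog_lift_factor hF nzF EF.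
have dehomZX k : dehom 0 ('X_iZ ^+ k) = 1 by rewrite rmorphXn /= dehomX expr1n.
have [leda|ltad] := leqP d a.
  exists ('X_iZ ^+ (a - d) * Q); rewrite mulrA FE; congr (_ * _).
  apply: (dehom0_inj hP); last by rewrite rmorphM /= dehomZX mulr1.
  have := dhomogM hG (dhomogMn (a - d) (dhomog_var iZ)).
  by rewrite mul1n subnKC.
have GE : G = P * 'X_iZ ^+ (d - a).
  apply: (dehom0_inj hG); last by rewrite rmorphM /= dehomZX mulr1.
  have := dhomogM hP (dhomogMn (d - a) (dhomog_var iZ)).
  by rewrite mul1n subnKC // ltnW.
case: irrG => _ /(_ _ _ GE) [/msize1_polyC PE|/msize1_polyC ZE].
  have := GO; rewrite GE rmorphM /= varZ_ptO mulr1 PE mevalC => c0.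
  by have := irreducible_neq0; rewrite GE PE c0 mpolyC0 mul0r eqxx.
(* A constant positive power of Z would take equal values at [ptO], where it is 1, and at the zero
   vector, where it is 0. *)
move: ZE; set c := (X in X%:MP_[_]) => ZE.
have := congr1 (meval (fun _ => 0)) ZE; have := congr1 (meval ptO) ZE.
rewrite varZ_ptO rmorphXn /= mevalXU !mevalC expr0n subn_eq0 leqNgt ltad => <- /eqP.
by rewrite eq_sym oner_eq0.
Qed.

Lemma irreducible_form_prime b h A B H : B \is b.-homog -> H \is h.-homog ->
  A * G = B * H -> (exists Q, B = G * Q) \/ (exists Q, H = G * Q).
Proof.
move=> hB hH /(congr1 (dehom 0)); rewrite !rmorphM /=.
case/(irreducible_bivar_prime _ dehom_irreducible).
(* The nonzero Y-derivative at [O] gives the dehomogenized [G] positive degree in y. *)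
- rewrite ltnNge; apply/negP => /leq_sizeP /(_ 1%N (leqnn _)) E.
  by have := dGO; rewrite -(@coef10_dehom 0) ?coef0 // E coef0 eqxx.
- by case=> q /(dvd_of_dehom hB); left.
- by case=> q /(dvd_of_dehom hH); right.
Qed.

End Prime.

(** * Homogeneous factors and linear algebra *)

Section HomogFactor.
Variables (n : nat) (R : idomainType).
Implicit Types P Q F : {mpoly R[n]}.

Lemma pihomog_mull e b P Q : P \is e.-homog ->
  pihomog mdeg (e + b) (P * Q) = P * pihomog mdeg b Q.
Proof.
move=> hP; pose k := maxn (msize Q) b.+1.
rewrite {1}(@pihomog_partitionE _ _ mdeg k Q) ?leq_maxl // mulr_sumr linear_sum /=.
have ltbk : (b < k)%N by rewrite leq_max leqnn orbT.
rewrite (bigD1 (Ordinal ltbk)) //= pihomog_dE; last exact: dhomogM (pihomogP _ _ _).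
rewrite big1 ?addr0 // => i; rewrite -val_eqE /= => neib.
apply: (@pihomog_ne0 _ _ _ (e + i)); first by rewrite eqn_add2l.
exact: dhomogM (pihomogP _ _ _).
Qed.

(** For each degree occurring in [Q], [P] times that component of [Q] is a nonzero homogeneous
    component of [F], so the degrees add up to [k]. *)
Lemma homog_factor k e P Q F : F != 0 -> F \is k.-homog -> P \is e.-homog ->
  F = P * Q -> (e <= k)%N /\ Q \is (k - e).-homog.
Proof.
move=> nzF hF hP FE.
have [nzP nzQ] : P != 0 /\ Q != 0.
  by apply/andP; rewrite -negb_or -mulf_eq0 -FE.
have degQ m : m \in msupp Q -> (e + mdeg m = k)%N.
  move=> min; apply/eqP/negPn/negP => ne.
  have /eqP := pihomog_mull (mdeg m) Q hP.
  rewrite -FE (@pihomog_ne0 _ _ _ k) 1?eq_sym // mulf_eq0 (negPf nzP) /=.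
  move/eqP/(congr1 (mcoeff m)); rewrite mcoeff0 pihomogE raddf_sum /=.
  rewrite big_mkcond (bigD1_seq m) ?msupp_uniq //= eqxx mcoeffZ mcoeffX eqxx mulr1.
  rewrite big1 ?addr0; first by apply/eqP; rewrite -mcoeff_msupp.
  by move=> m' /negPf nm; case: ifP => // _; rewrite mcoeffZ mcoeffX nm mulr0.
have := degQ _ (mlead_supp nzQ) => /esym k0; split; first by rewrite k0 leq_addr.
by apply/dhomogP => m /degQ <-; rewrite addKn.
Qed.

End HomogFactor.

Section LinearAlgebra.
Variable K : fieldType.

Lemma common_kernel (V : vectType K) (T : Type) (r : seq T) (f : T -> V -> K) :
    (forall t c u v, f t (c *: u + v) = c * f t u + f t v) ->
    (size r < dim V)%N ->
  exists2 v : V, v != 0 & forall i : 'I_(size r), f (tnth (in_tuple r) i) v = 0.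
Proof.
move=> flin ltr; pose L (v : V) := \row_(i < size r) f (tnth (in_tuple r) i) v.
have Llin : linear L by move=> c u v; apply/rowP => i; rewrite !mxE flin.
pose LL := GRing.isLinear.Build _ _ _ _ L Llin.
pose Lf : {linear V -> 'rV[K]_(size r)} := HB.pack L LL.
have := limg_ker_dim (linfun Lf) fullv; rewrite capfv dimvf => E.
have : (0 < \dim (lker (linfun Lf)))%N.
  rewrite lt0n; apply: contraTneq ltr => k0; rewrite -leqNgt -E k0 add0n.
  by rewrite (leq_trans (dimvS (subvf _))) // dimvf /dim /= mul1n.
rewrite lt0n dimv_eq0 -vpick0 => nz; exists (vpick (lker (linfun Lf))) => // i.
have := memv_pick (lker (linfun Lf)); rewrite memv_ker lfunE => /eqP.
by move/rowP/(_ i); rewrite !mxE.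
Qed.

(** The kernel of [L] has dimension at least dim U - dim W, which exceeds the rank of [M]. This will
    provide a relation that is not a trivial syzygy. *)
Lemma kernel_exceeds_image (T U W : vectType K)
    (M : {linear T -> U}) (L : {linear U -> W}) :
  (dim T + dim W < dim U)%N -> exists2 u, L u = 0 & forall t, u <> M t.
Proof.
move=> lt; have := limg_ker_dim (linfun L) fullv; rewrite capfv dimvf => E.
have : ~~ (lker (linfun L) <= limg (linfun M))%VS.
  apply: contraTN lt => /dimvS le; rewrite -leqNgt -E; apply: leq_add.
    apply: leq_trans le _; have := limg_ker_dim (linfun M) fullv.
    by rewrite dimvf => <-; rewrite leq_addl.
  by rewrite (leq_trans (dimvS (subvf _))) // dimvf.
case/subvPn => u; rewrite memv_ker lfunE /= => /eqP Lu0 nin; exists u => // t ut.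
by case/negP: nin; rewrite ut -(lfunE M) memv_img ?memvf.
Qed.

End LinearAlgebra.

(** * Bezout at a smooth point *)

Local Notation form k := (dhomog 3 CC k).

Lemma dim_form k : (dim (form k) * 2 = k.+2 * k.+1)%N.
Proof.
rewrite (_ : dim (form k) = 'C(k.+2, 2)); first by rewrite bin_ffact !ffactnS ffactn0 muln1.
have -> : dim (form k) = 'C(k + 2, k) by [].
by rewrite -bin_sub ?leq_addr // addKn addn2.
Qed.

Lemma indhomogE k (F : {mpoly CC[3]}) :
  F \is k.-homog -> mpoly_of_dhomog (indhomog k F) = F.
Proof. by move=> hF; rewrite -[LHS]/(val (indhomog k F)) /indhomog insubdK. Qed.

Section Bezout.
Variables (d : nat) (G : {mpoly CC[3]}) (xi : ps).
Hypotheses (hG : G \is d.-homog) (irrG : mirreducible G) (GO : G.@[ptO] = 0)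
  (dGO : (mderiv iY G).@[ptO] != 0) (Gxi : forall i, expand xi G i 0 = 0).
Variables (e : nat) (H : {mpoly CC[3]}).
Hypothesis hH : H \is e.-homog.

Let p := (d * e)%N.
(** A triple holds the multipliers of [G] and [H] and the coefficients of [p + 1] monomials; all
    three contributions land in degree [p + d + e]. *)
Let U : vectType CC := (form (p + e) * form (p + d) * 'rV[CC]_p.+1)%type.

Let Lval (u : U) : {mpoly CC[3]} := val u.1.1 * G + val u.1.2 * H +
  \sum_(i < p.+1) u.2 0 i *: ('X_iX ^+ i * 'X_iZ ^+ (p + d + e - i)).

Let Lval_homog u : Lval u \is (p + d + e).-homog.
Proof.
apply: rpredD; first apply: rpredD.
- by have := dhomogM (valP u.1.1) hG; rewrite addnAC.
- exact: dhomogM (valP u.1.2) hH.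
- apply: rpred_sum => i _; apply: dhomogZ.
  have := dhomogM (dhomogMn i (dhomog_var iX)) (dhomogMn (p + d + e - i) (dhomog_var iZ)).
  by rewrite !mul1n subnKC //; have := ltn_ord i; lia.
Qed.

Let L (u : U) : form (p + d + e) := indhomog _ (Lval u).

Let L_linear : linear L.
Proof.
move=> c u v; apply: val_inj; rewrite linearP /= !indhomogE //.
rewrite /Lval /= !mulrDl -!scalerAl !scalerDr scaler_sumr.
rewrite (eq_bigr (fun i => c *: (u.2 0 i *: ('X_iX ^+ i * 'X_iZ ^+ (p + d + e - i)))
   + v.2 0 i *: ('X_iX ^+ i * 'X_iZ ^+ (p + d + e - i)))); last first.
  by move=> i _; rewrite !mxE scalerDl scalerA.
by rewrite big_split /=; ring.
Qed.

(** The Koszul relations (- t H) G + (t G) H = 0, which lie in the kernel of [L] for any [H]. *)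
Let M (t : form p) : U :=
  (indhomog _ (- (val t * H)), indhomog _ (val t * G), 0).

Let M_linear : linear M.
Proof.
have EH (t : form p) : val (indhomog (p + e) (- (val t * H))) = - (val t * H).
  rewrite [LHS]indhomogE //; have := dhomogM (valP t) hH; by rewrite -dhomogN.
have EG (t : form p) : val (indhomog (p + d) (val t * G)) = val t * G.
  by rewrite [LHS]indhomogE //; exact: dhomogM (valP t) hG.
move=> c u v; rewrite /M; congr (_, _, _); last by rewrite /= scaler0 addr0.
- apply: val_inj; rewrite EH [val (_ + _)]/(c *: val u + val v).
  rewrite [RHS]/(c *: val (indhomog (p + e) (- (val u * H)))
                 + val (indhomog (p + e) (- (val v * H)))) !EH.
  by rewrite mulrDl -scalerAl opprD scalerN.
- apply: val_inj; rewrite EG [val (_ + _)]/(c *: val u + val v).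
  rewrite [RHS]/(c *: val (indhomog (p + d) (val u * G))
                 + val (indhomog (p + d) (val v * G))) !EG.
  by rewrite mulrDl -scalerAl.
Qed.

Lemma intersection_order_le : ~ (exists Q, H = G * Q) ->
  exists2 o, (o <= d * e)%N & expand xi H o 0 != 0.
Proof.
move=> ndvd; apply: NNPP => none.
have Hxi i : (i <= p)%N -> expand xi H i 0 = 0.
  by move=> le; apply/eqP/negPn/negP => nz; case: none; exists i.
pose Ll : {linear U -> form (p + d + e)} :=
  HB.pack L (GRing.isLinear.Build _ _ _ _ L L_linear).
pose Ml : {linear form p -> U} := HB.pack M (GRing.isLinear.Build _ _ _ _ M M_linear).
(* The mixed second difference of (n + 2)(n + 1)/2 with steps d and e is d e = p, and the p + 1
   monomials exceed it by exactly one. *)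
have lt : (dim (form p) + dim (form (p + d + e)) < dim U)%N.
  have -> : dim U = (dim (form (p + e)) + dim (form (p + d)) + 1 * p.+1)%N by [].
  move: (dim_form p) (dim_form (p + e)) (dim_form (p + d)) (dim_form (p + d + e)).
  have : p = (d * e)%N by [].
  move: (dim _) (dim _) (dim _) (dim _) => *; nia.
have [u /(congr1 val)] := kernel_exceeds_image Ml Ll lt.
rewrite [val (Ll u)]indhomogE // [val 0]/= => Lu0 uM.
(* Along the curve the multiple of [G] vanishes and that of [H] vanishes up to order p, so the
   relation reads off each coefficient of [u.2]. *)
have c0 (i : 'I_p.+1) : u.2 0 i = 0.
  have := congr1 (fun F => expand xi F i 0) Lu0; rewrite /Lval expand0.
  rewrite !expandD expand_sum.
  have mul0 A B : (forall a, (a <= p)%N -> expand xi B a 0 = 0) ->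
      expand xi (A * B) i 0 = 0.
    move=> B0; rewrite expandM big_ord1 big1 // => a _; rewrite subn0 B0 ?mulr0 //.
    by have := ltn_ord i; lia.
  rewrite !mul0 // !add0r (bigD1 i) //= expandZ expand_XZ eqxx mulr1 big1 ?addr0 //.
  move=> a; rewrite -val_eqE /= eq_sym => /negPf ne.
  by rewrite expandZ expand_XZ ne mulr0.
move: Lu0; rewrite /Lval [X in _ + X]big1 => [|i _]; last by rewrite c0 scale0r.
rewrite addr0 => /eqP; rewrite addr_eq0 -mulNr => /eqP AB.
have hB : - val u.1.2 \is (p + d).-homog by rewrite rpredN; exact: valP.
(* What remains is A G = - B H; as [G] does not divide [H], primality makes it divide - B. *)
have [[Q BE]|//] := irreducible_form_prime hG irrG GO dGO hB hH AB.
have nzG := irreducible_neq0 dGO.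
have hQ : Q \is p.-homog.
  have [Q0|nzQ] := eqVneq Q 0; first by rewrite Q0 rpred0.
  have nzB : - val u.1.2 != 0 by rewrite BE mulf_neq0.
  by have [_] := homog_factor nzB hB hG BE; rewrite addnK.
(* From - B = G Q the relation is the Koszul one of - Q, contrary to the choice of [u]. *)
apply: (uM (DHomog (_ : - Q \is p.-homog))); first by rewrite rpredN.
move=> hNQ; rewrite [RHS]/(M _) /M /=; case: u AB BE c0 {uM hB} => [[A B] c] /= AB BE c0.
congr (_, _, _).
- apply: val_inj; rewrite /= indhomogE; last by rewrite rpredN dhomogM.
  by apply: (mulIf nzG); rewrite AB BE; ring.
- apply: val_inj; rewrite /= indhomogE ?dhomogM //.
  by rewrite -[LHS]opprK BE; ring.
- by apply/rowP => i; rewrite c0 mxE.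
Qed.

End Bezout.

(** * Valuations of forms *)

(** Up to the factor [d ^ 2] and one extra point per row, this counts the conditions imposed in
    [corner_form]. *)
Lemma sum_sub_maxn r n : (r <= n)%N ->
  ((\sum_(j < n.+1) (n - maxn j r)) * 2 = (n - r) * (n + r).+1)%N.
Proof.
move=> /subnKC <-; elim: (n - r)%N => [|t IHt] {n}.
  rewrite addn0 subnn mul0n big1 // => j _; apply/eqP; rewrite subn_eq0 leq_maxr //.
rewrite addnS big_ord_recr /=.
rewrite (eq_bigr (fun j : 'I__ => (r + t - maxn j r) + 1)%N); last first.
  by move=> j _; have := ltn_ord j; lia.
rewrite big_split /= sum_nat_const card_ord muln1.
have -> : ((r + t).+1 - maxn (r + t).+1 r = 0)%N by lia.
have -> : ((r + t).+1 - r = t.+1)%N by lia.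
by rewrite addKn in IHt; rewrite addn0 mulnDl IHt; lia.
Qed.

(** With [n = r ^ 2] the - r^2 coming from the cut cancels + n, so 2 S = n^2 - r. Then 2 d^2 S + 2 n
    + 2 stays below (d n)^2 + 3 d n + 2 = 2 D. *)
Lemma corner_count_lt d r n S D : (0 < d)%N -> (0 < r)%N -> (n = r ^ 2)%N ->
    (r <= n)%N -> (S * 2 = (n - r) * (n + r).+1)%N ->
    (D * 2 = (d * n).+2 * (d * n).+1)%N ->
  (d ^ 2 * S + n.+1 < D)%N.
Proof.
move=> d_gt0 r_gt0 nE lern ES ED.
have {}ES : (S * 2 + r = n * n)%N.
  have [t nt] : exists t, n = (t + r)%N by exists (n - r)%N; rewrite subnK.
  have : (t + r = r * r)%N by rewrite -nt nE.
  by rewrite ES nt addnK; lia.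
have {}ES : (d ^ 2 * S * 2 + d ^ 2 * r = (d * n) * (d * n))%N.
  by rewrite -mulnA -mulnDr ES mulnACA.
have led : (n <= d * n)%N by rewrite leq_pmull.
have gt0 : (0 < d ^ 2 * r)%N by rewrite muln_gt0 expn_gt0 d_gt0.
rewrite -(ltn_pmul2r (_ : 0 < 2)%N) // ED mulnDl {ED nE lern}.
by move: (d ^ 2 * S)%N (d ^ 2 * r)%N (d * n)%N led gt0 ES => x y z led gt0 ES; lia.
Qed.

(** The points left free have j < r and i within d^2 r of d k; after division by k = d r^2 both
    deviations from the vertex are of order 1/r. *)
Lemma corner_form d (xi : ps) r : (0 < d)%N -> (0 < r)%N -> exists2 F : {mpoly CC[3]},
  F \is (d * r ^ 2).-homog /\ F != 0 &
  forall i j, (i + d ^ 2 * j <= d * (d * r ^ 2))%N -> expand xi F i j != 0 ->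
    (j < r)%N /\ (d ^ 2 * (r ^ 2 - r) < i)%N.
Proof.
move=> d_gt0 r_gt0; set n := (r ^ 2)%N; set k := (d * n)%N.
have lern : (r <= n)%N by rewrite /n; nia.
(* Rows j >= r of the triangle i + d^2 j <= d k are taken in full, rows j < r only up to i = d^2 (n
   - r), which frees the corner. *)
pose l := [seq (i, j) | j <- iota 0 n.+1, i <- iota 0 (d ^ 2 * (n - maxn j r)).+1].
have szl : (size l < dim (form k))%N.
  rewrite /l size_allpairs_dep (_ : sumn _ = \sum_(j < n.+1) (d ^ 2 * (n - maxn j r)).+1)%N.
    under eq_bigr => j _ do rewrite -addn1.
    rewrite big_split /= -big_distrr /= sum_nat_const card_ord.
    have := dim_form k; have := sum_sub_maxn lern.
    move: (\sum_(j < _) _)%N (dim _) => S D ES ED.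
    by rewrite muln1; apply: corner_count_lt d_gt0 r_gt0 erefl lern ES ED.
  by rewrite sumnE big_map -{1}[iota _ _]/(index_iota 0 n.+1) big_mkord;
    apply: eq_bigr => j _; rewrite size_iota.
have [F nzF F0] := common_kernel (V := form k)
  (f := fun (t : nat * nat) F => expand xi (val F) t.1 t.2)
  (fun t c F H => expandP xi c (val F) (val H) t.1 t.2) szl.
exists (val F); first by split=> //; exact: valP.
have inl i j : (i, j) \in l -> expand xi (val F) i j = 0.
  move=> /(nthP (0, 0)%N)[a lta E]; have := F0 (Ordinal lta).
  by rewrite (tnth_nth (0, 0)%N) /= E.
move=> i j le nz.
have lejn : (j <= n)%N.
  rewrite -(leq_pmul2l (_ : 0 < d ^ 2)%N) ?expn_gt0 ?d_gt0 //.
  by apply: leq_trans (leq_addl i _) _; rewrite (leq_trans le) // mulnA.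
have lti : (d ^ 2 * (n - maxn j r) < i)%N.
  rewrite ltnNge; apply: contraNN nz => lei; apply/eqP/inl/allpairsPdep.
  by exists j, i; rewrite !mem_iota /= !add0n !ltnS.
have ltjr : (j < r)%N.
  rewrite ltnNge; apply/negP => lerj; move: lti; rewrite (maxn_idPl lerj).
  rewrite mulnBr ltnNge => /negP; apply.
  rewrite leq_subRL; last by rewrite leq_mul2l lejn orbT.
  by rewrite addnC (leq_trans le) // mulnA.
by split=> //; move: lti; rewrite (maxn_idPr (ltnW ltjr)).
Qed.

(** * Indices of the two valuations along the curve *)

Section Curve.
Variables (d : nat) (G : {mpoly CC[3]}) (xi : ps).
Hypotheses (d_gt0 : (0 < d)%N) (hG : G \is d.-homog) (irrG : mirreducible G)
  (GO : G.@[ptO] = 0) (dGO : (mderiv iY G).@[ptO] != 0)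
  (xi0 : xi 0%N = 0) (Gxi : forall i, expand xi G i 0 = 0).

Lemma expand_curve01 : expand xi G 0 1 != 0.
Proof.
by rewrite (@expand_dehom _ 1) // coef10_dehom // /ps_trunc coef_poly.
Qed.

(* Along [C] the form [G] is a unit times [y - xi], so [G ^+ m] shifts the
   expansion by [m] in the second index. *)
Lemma expand_mul_curve_pow m o H : ps_ord (fun i => expand xi H i 0) o ->
  [/\ forall i j, (j < m)%N -> expand xi (G ^+ m * H) i j = 0,
      forall i, (i < o)%N -> expand xi (G ^+ m * H) i m = 0
    & expand xi (G ^+ m * H) o m != 0].
Proof.
case=> Ho Hlo; elim: m => [|m [IHlt IHo IHnz]]; first by rewrite mul1r.
have rec i j : expand xi (G ^+ m.+1 * H) i j = \sum_(b < j.+1) \sum_(a < i.+1)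
    expand xi G a b * expand xi (G ^+ m * H) (i - a) (j - b).
  by rewrite exprS -mulrA expandM.
(* Only b = 1 survives: row 0 of [G] vanishes, and for b >= 2 the other factor is in a row below
   [m]. *)
have rec1 i : expand xi (G ^+ m.+1 * H) i m.+1 =
    \sum_(a < i.+1) expand xi G a 1 * expand xi (G ^+ m * H) (i - a) m.
  rewrite rec big_ord_recl big1 ?add0r => [|a _]; last by rewrite Gxi mul0r.
  rewrite big_ord_recl [X in _ + X]big1 ?addr0 => [|b _].
    by apply: eq_bigr => a _; rewrite subn1.
  by rewrite big1 // => a _; rewrite IHlt ?mulr0 //= /bump /=; have := ltn_ord b; lia.
split=> [i j ltj|i lti|].
- rewrite rec big1 // => -[[|b] ltb] _; rewrite big1 // => a _ /=.
    by rewrite Gxi mul0r.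
  by rewrite IHlt ?mulr0 //; lia.
- by rewrite rec1 big1 // => a _; rewrite IHo ?mulr0 //; lia.
rewrite rec1 big_ord_recl subn0 big1 ?addr0 => [|a _].
  by rewrite mulf_neq0 // expand_curve01.
by rewrite IHo ?mulr0 //= /bump /=; have := ltn_ord a; lia.
Qed.

(** Dividing by [G] lowers the degree by [d > 0], so it can be repeated only finitely often. *)
Lemma curve_factorization k F : F \is k.-homog -> F != 0 ->
  exists m H, F = G ^+ m * H /\ ~ (exists Q, H = G * Q).
Proof.
have [b] := ubnP k; elim: b k F => // b IHb k F ltk hF nzF.
have [[Q FE]|] := classic (exists Q, F = G * Q); last by exists 0%N, F; rewrite mul1r.
have [ledk hQ] := homog_factor nzF hF hG FE.
have ltkd : (k - d < b)%N by lia.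
have nzQ : Q != 0 by apply: contraNneq nzF => Q0; rewrite FE Q0 mulr0.
have [m [H [QE ndvd]]] := IHb _ Q ltkd hQ nzQ.
by exists m.+1, H; split=> //; rewrite FE QE exprS mulrA.
Qed.

Lemma order_along_curve k F m H : F \is k.-homog -> F != 0 -> F = G ^+ m * H ->
    ~ (exists Q, H = G * Q) ->
  exists2 o, ps_ord (fun i => expand xi H i 0) o & (o + d ^ 2 * m <= d * k)%N.
Proof.
move=> hF nzF FE ndvd.
have [ledk hH] := homog_factor nzF hF (dhomogMn m hG) FE.
have [o' leo nz] := intersection_order_le hG irrG GO dGO Gxi hH ndvd.
have ex : exists o, expand xi H o 0 != 0 by exists o'.
exists (ex_minn ex); case: ex_minnP => o nzo omin.
  by split=> // i lti; apply/eqP/negPn/negP => /omin; rewrite leqNgt lti.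
(* [ledk] makes the truncated subtraction in the Bezout bound [d * (k - d * m)] exact. *)
have := omin _ nz; nia.
Qed.

Lemma ps_ord_uniq h o o' : ps_ord h o -> ps_ord h o' -> o = o'.
Proof.
move=> [nz lo] [nz' lo']; case: (ltngtP o o') => // lt.
  by rewrite lo' // eqxx in nz.
by rewrite lo // eqxx in nz'.
Qed.

(** Uniqueness of the order transfers the Bezout bound to any witness of [nu_at]; the nonzero
    coefficient is what [corner_form] asks of an index. *)
Lemma nu_at_bound k F m o : F \is k.-homog -> F != 0 -> nu_at G xi F m o ->
  (o + d ^ 2 * m <= d * k)%N /\ expand xi F o m != 0.
Proof.
move=> hF nzF [H [FE [ndvd ord]]].
have [o' ord' le] := order_along_curve hF nzF FE ndvd.
rewrite (ps_ord_uniq ord ord'); split=> //.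
by rewrite FE; have [_ _] := expand_mul_curve_pow m ord'.
Qed.

Lemma nu_at_exists k F : F \is k.-homog -> F != 0 -> exists m o, nu_at G xi F m o.
Proof.
move=> hF nzF; have [m [H [FE ndvd]]] := curve_factorization hF nzF.
by have [o ord _] := order_along_curve hF nzF FE ndvd; exists m, o, H.
Qed.

Section Slope.
Variable s : rat.
Hypothesis s_ge : ((d ^ 2)%N)%:Q <= s.

Let s_ge1 : 1 <= s.
Proof. by apply: le_trans s_ge; rewrite (ler_nat rat 1) expn_gt0 d_gt0. Qed.

(** Rows below [m] vanish, so j >= m. Minimality gives i + s j <= o + s m, and with s >= d^2 this
    yields i + d^2 j <= o + d^2 m. *)
Lemma vplus_at_bound k F i j : F \is k.-homog -> F != 0 -> vplus_at xi s F i j ->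
  (i + d ^ 2 * j <= d * k)%N.
Proof.
move=> hF nzF [nzij minij].
have [m [H [FE ndvd]]] := curve_factorization hF nzF.
have [o ord le] := order_along_curve hF nzF FE ndvd.
have [lo _ nz] := expand_mul_curve_pow m ord.
have lemj : (m <= j)%N.
  by rewrite leqNgt; apply/negP => ltjm; rewrite FE lo // eqxx in nzij.
rewrite -FE in nz; have [le1 _] := minij _ _ nz.
rewrite -(ler_nat rat); move: le; rewrite -(ler_nat rat) => le.
have lemjQ : m%:R <= j%:R :> rat by rewrite ler_nat.
apply: le_trans le; rewrite !natrD !natrM.
move: le1 s_ge lemjQ; rewrite -!pmulrn => le1 s_ge' lemjQ.
have : 0 <= (s - (d ^ 2)%:R) * (j%:R - m%:R) by rewrite mulr_ge0 // subr_ge0.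
lra.
Qed.

Lemma vplus_at_exists k F : F \is k.-homog -> F != 0 -> exists i j, vplus_at xi s F i j.
Proof.
move=> hF nzF; have [m [o nuF]] := nu_at_exists hF nzF.
have [_ nz] := nu_at_bound hF nzF nuF.
pose val (i j : nat) : rat := i%:Q + s * j%:Q.
(* As s >= 1, the indices whose value is at most that of (o, m) lie in a finite box, where a minimum
   exists. *)
have [B ltB] : exists B : nat, val o m < B%:R.
  exists (Num.bound (val o m)); apply: archi_boundP.
  by rewrite /val -!pmulrn addr_ge0 ?mulr_ge0 ?(le_trans ler01 s_ge1).
have small i j : val i j <= val o m -> (i < B.+1)%N /\ (j < B.+1)%N.
  move=> le; rewrite !ltnS -!(ler_nat rat); move: (le_lt_trans le ltB).
  rewrite /val -!pmulrn => lt.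
  have i0 : 0 <= i%:R :> rat by [].
  have j0 : 0 <= j%:R :> rat by [].
  have : j%:R <= s * j%:R by rewrite ler_peMl.
  by move=> sj; split; apply: ltW; lra.
have [om mm] := small _ _ (lexx (val o m)).
pose x0 : 'I_B.+1 * 'I_B.+1 := (Ordinal om, Ordinal mm).
pose P := [pred x : 'I_B.+1 * 'I_B.+1 | expand xi F x.1 x.2 != 0].
have Px0 : P x0 by [].
case: (arg_minP (fun x : 'I_B.+1 * 'I_B.+1 => val x.1 x.2) Px0) => x1 Px1 min1.
pose P2 := [pred x : 'I_B.+1 * 'I_B.+1 | P x && (val x.1 x.2 == val x1.1 x1.2)].
have P2x1 : P2 x1 by apply/andP; split.
(* The second minimization picks the least j among the indices of minimal value. *)
case: (fintype.arg_minnP (fun x : 'I_B.+1 * 'I_B.+1 => x.2 : nat) P2x1).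
move=> [i j] /= /andP[nzij /eqP Eij] min2; exists i, j; split=> // i' j' nz'.
have le_o : val x1.1 x1.2 <= val o m := min1 _ Px0.
rewrite -!/(val _ _) Eij.
(* An index of value above that of (o, m) cannot tie with the minimum; any other index lies in the
   box. *)
have [lt|] := ltP (val o m) (val i' j').
  split; first exact: le_trans (ltW lt).
  by move=> E; move: lt; rewrite E ltNge le_o.
case/small => lti ltj; have := min1 (Ordinal lti, Ordinal ltj) nz' => /= le1.
by split=> // E; apply: (min2 (Ordinal lti, Ordinal ltj)); rewrite /= nz' E eqxx.
Qed.

End Slope.

End Curve.

(** * Triangles in the plane *)

Lemma closure2_sub (S : set2) p : S p -> closure2 S p.
Proof. by move=> Sp e e0; exists p; rewrite !subrr normr0. Qed.

Lemma conv_hull_mono (S T : set2) p :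
  (forall q, S q -> T q) -> conv_hull S p -> conv_hull T p.
Proof. by move=> ST [n [w [q [w0 [w1 [Sq E]]]]]]; exists n, w, q; do !split=> //; auto. Qed.

(** Each point of the combination is approximated within [e] and the weights are kept. *)
Lemma conv_hull_closure (S : set2) p :
  conv_hull (closure2 S) p -> closure2 (conv_hull S) p.
Proof.
move=> [n [w [q [w0 [w1 [Sq ->]]]]]] e e0.
have /fin_all_exists[q' q'P] i := Sq i e e0.
exists (\sum_(i < n) w i * (q' i).1, \sum_(i < n) w i * (q' i).2); split.
  by exists n, w, q'; do !split=> //; move=> i; have [] := q'P i.
have near (f : RR * RR -> RR) : (forall i, `|f (q i) - f (q' i)| < e) ->
    `|\sum_(i < n) w i * f (q i) - \sum_(i < n) w i * f (q' i)| < e.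
  move=> fe; rewrite -sumrB.
  (* The bound must be strict although weights may be zero; a term of positive weight supplies the
     strictness. *)
  have [i0 wi0] : exists i, 0 < w i.
    apply: NNPP => none; have /eqP := w1; rewrite big1 ?(eq_sym 0) ?oner_eq0 // => i _.
    by apply/eqP; rewrite eq_le w0 andbT leNgt; apply/negP => wi; apply: none; exists i.
  have -> : e = \sum_(i < n) w i * e by rewrite -mulr_suml w1 mul1r.
  apply: le_lt_trans (ler_norm_sum _ _ _) _.
  rewrite (bigD1 i0) //= [ltRHS](bigD1 i0) //= ltr_leD //.
    by rewrite -mulrBr normrM ger0_norm // ltr_pM2l.
  by apply: ler_sum => i _; rewrite -mulrBr normrM ger0_norm // ler_wpM2l // ltW.
by split; apply: near => i; have [_ []] := q'P i.
Qed.

Lemma affine_ge0_conv_hull (a b c : RR) (S : set2) p :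
    (forall q, S q -> 0 <= a + b * q.1 + c * q.2) ->
  conv_hull S p -> 0 <= a + b * p.1 + c * p.2.
Proof.
move=> Sge [n [w [q [w0 [w1 [Sq ->]]]]]] /=.
have -> : a + b * (\sum_(i < n) w i * (q i).1) + c * (\sum_(i < n) w i * (q i).2) =
    \sum_(i < n) w i * (a + b * (q i).1 + c * (q i).2).
  rewrite -[X in X + _ + _]mulr1 -w1 !mulr_sumr -!big_split /=.
  by apply: eq_bigr => i _; ring.
by apply: sumr_ge0 => i _; rewrite mulr_ge0 // Sge.
Qed.

Lemma affine_ge0_closure (a b c : RR) (S : set2) p :
    (forall q, S q -> 0 <= a + b * q.1 + c * q.2) ->
  closure2 S p -> 0 <= a + b * p.1 + c * p.2.
Proof.
move=> Sge Sp; rewrite leNgt; apply/negP => lt0.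
(* Within distance [e] in each coordinate the affine function changes by at most (|b| + |c|) e, less
   than the violation e D; the 1 also keeps [D] positive. *)
pose D := `|b| + `|c| + 1.
have D0 : 0 < D by rewrite ltr_wpDl ?addr_ge0.
pose e := - (a + b * p.1 + c * p.2) / D.
have e0 : 0 < e by rewrite divr_gt0 // oppr_gt0.
have [q [/Sge Sq [n1 n2]]] := Sp e e0.
have eD : e * D = - (a + b * p.1 + c * p.2) by rewrite divfK // gt_eqF.
have b1 : b * (q.1 - p.1) <= `|b| * e.
  by rewrite (le_trans (ler_norm _)) // normrM distrC ler_wpM2l // ltW.
have b2 : c * (q.2 - p.2) <= `|c| * e.
  by rewrite (le_trans (ler_norm _)) // normrM distrC ler_wpM2l // ltW.
rewrite /D in eD; lra.
Qed.

Lemma triangleP (a b c : RR) p : 0 < a -> 0 < c ->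
  triangle a b c p <-> [/\ 0 <= p.2, b * p.2 <= c * p.1 &
    c * p.1 - b * p.2 + a * p.2 <= a * c].
Proof.
move=> a0 c0; split.
  move=> Tp.
  have aff := fun x y z H => @affine_ge0_conv_hull x y z _ p H Tp.
  have ac : 0 < a * c by rewrite mulr_gt0.
  split.
  - have := aff 0 0 1; rewrite add0r mul0r mul1r add0r; apply=> q.
    by rewrite !mul0r !add0r mul1r => -[->|[->|->]] //=; exact: ltW.
  - rewrite -subr_ge0; have := aff 0 c (- b); rewrite add0r mulNr; apply=> q.
    by move=> [->|[->|->]] /=; nra.
  - rewrite -subr_ge0 (_ : _ - _ = a * c + (- c) * p.1 + (b - a) * p.2); last by ring.
    by apply: aff => q; move=> [->|[->|->]] /=; nra.
case: p => t u /= [u0 h1 h2].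
(* Barycentric coordinates of (t, u) at (b, c) and (a, 0); the three inequalities say that they and
   [1 - w1 - w2] are nonnegative. *)
pose w2 := u / c; pose w1 := (c * t - b * u) / (a * c).
exists 3%N, (fun i => if i == iX then 1 - w1 - w2 else if i == iY then w1 else w2),
  (fun i => if i == iX then (0, 0) else if i == iY then (a, 0) else (b, c)).
have ac : 0 < a * c by rewrite mulr_gt0.
have nza : a != 0 by rewrite gt_eqF.
have nzc : c != 0 by rewrite gt_eqF.
split.
  move=> i; case: ifP => _; [|case: ifP => _].
  - rewrite (_ : 1 - w1 - w2 = (a * c - (c * t - b * u + a * u)) / (a * c)).
      by rewrite divr_ge0 ?subr_ge0 // ltW.
    by rewrite /w1 /w2; field; rewrite ?nza ?nzc.
  - by rewrite divr_ge0 ?subr_ge0 // ltW.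
  - by rewrite divr_ge0 // ltW.
split; first by rewrite !big_ord_recl big_ord0 /=; ring.
split; first by move=> i; case: ifP => _; [left|case: ifP => _; right; [left|right]].
by rewrite !big_ord_recl !big_ord0 /= /w1 /w2; congr (_, _); field; rewrite ?nza ?nzc.
Qed.

(** The vertices need only be limits of points of [S], which is how corner forms will supply one of
    them. The other inclusion holds because half-planes are convex and closed. *)
Lemma closure_conv_hull_triangle (a b c : RR) (S : set2) : 0 < a -> 0 < c ->
    (forall p, S p -> triangle a b c p) ->
    closure2 S (0, 0) -> closure2 S (a, 0) -> closure2 S (b, c) ->
  seteq2 (closure2 (conv_hull S)) (triangle a b c).
Proof.
move=> a0 c0 ST S0 Sa Sb p; split=> [Sp|Tp]; last first.
  apply: conv_hull_closure; apply: conv_hull_mono Tp => q.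
  by case=> [->|[->|->]].
have aff x y z : (forall q, triangle a b c q -> 0 <= x + y * q.1 + z * q.2) ->
    0 <= x + y * p.1 + z * p.2.
  move=> T0; apply: affine_ge0_closure Sp => q Sq.
  by apply: affine_ge0_conv_hull Sq => q' /ST/T0.
apply/triangleP => //; split.
- have := aff 0 0 1; rewrite add0r mul0r mul1r add0r; apply=> q /triangleP[] //.
  by rewrite !mul0r !add0r mul1r.
- rewrite -subr_ge0; have := aff 0 c (- b); rewrite add0r mulNr; apply=> q /triangleP[] //.
  by move=> *; lra.
- rewrite -subr_ge0 (_ : _ - _ = a * c + (- c) * p.1 + (b - a) * p.2); last by ring.
  by apply: aff => q /triangleP[] // *; lra.
Qed.

(** * The two bodies *)

Lemma RR_archimedean (x : RR) : exists n : nat, x < n%:R.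
Proof.
exists (Num.bound (`|x| : Rdefinitions.R)).
exact: le_lt_trans (ler_norm _) (archi_boundP (normr_ge0 x)).
Qed.

Lemma exists_small_quotient (x e : RR) : 0 < e -> exists2 r : nat, (0 < r)%N & x / r%:R < e.
Proof.
move=> e0; have [n lt] := RR_archimedean (x / e); exists n.+1 => //.
rewrite ltr_pdivrMr ?ltr0n // mulrC -ltr_pdivrMr // (lt_le_trans lt) //.
by rewrite ler_nat.
Qed.

Lemma corner_estimate (d r i j : nat) : (0 < d)%N -> (0 < r)%N ->
    (j < r)%N -> (d ^ 2 * (r ^ 2 - r) < i)%N ->
    (i + d ^ 2 * j <= d * (d * r ^ 2))%N ->
  let k : RR := (d * r ^ 2)%:R in
  [/\ 0 <= j%:R / k <= 1 / r%:R, i%:R / k <= d%:R & d%:R - d%:R / r%:R <= i%:R / k].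
Proof.
move=> d0 r0 ltj lti le k.
have dR : 0 < d%:R :> RR by rewrite ltr0n.
have rR : 0 < r%:R :> RR by rewrite ltr0n.
have kE : k = d%:R * r%:R ^+ 2 by rewrite /k natrM natrX.
have kR : 0 < k by rewrite kE mulr_gt0 // exprn_gt0.
have [nzd nzr] : d%:R != 0 :> RR /\ r%:R != 0 :> RR by rewrite !gt_eqF.
split.
- rewrite divr_ge0 ?ler0n ?(ltW kR) //= ler_pdivrMr //.
  rewrite (_ : 1 / r%:R * k = (d * r)%:R); last by rewrite kE natrM; field.
  by rewrite ler_nat (leq_trans (ltnW ltj)) // leq_pmull.
- by rewrite ler_pdivrMr // /k -natrM ler_nat (leq_trans _ le) // leq_addr.
- rewrite ler_pdivlMr //.
  rewrite (_ : _ * k = (d ^ 2 * (r ^ 2 - r))%:R); first by rewrite ler_nat ltnW.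
  by rewrite natrM natrB ?natrX ?kE; [field|rewrite -{1}(expn1 r) leq_pexp2l].
Qed.

Section Bodies.
Variables (d : nat) (G : {mpoly CC[3]}) (xi : ps).
Hypotheses (d_gt0 : (0 < d)%N) (hG : G \is d.-homog) (irrG : mirreducible G)
  (GO : G.@[ptO] = 0) (dGO : (mderiv iY G).@[ptO] != 0)
  (xi0 : xi 0%N = 0) (Gxi : forall i, expand xi G i 0 = 0).

Let dR : 0 < d%:R :> RR. Proof. by rewrite ltr0n. Qed.
Let nzd : d%:R != 0 :> RR. Proof. by rewrite gt_eqF. Qed.

Let bound_real k i j : (0 < k)%N -> (i + d ^ 2 * j <= d * k)%N ->
  i%:R / k%:R + d%:R ^+ 2 * (j%:R / k%:R) <= d%:R :> RR.
Proof.
move=> k0; rewrite -(ler_nat RR) natrD [(d ^ 2 * j)%:R]natrM natrX [(d * k)%:R]natrM => le.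
rewrite mulrA -mulrDl ler_pdivrMr ?ltr0n //.
Qed.

Lemma expand_varZ : expand xi 'X_iZ 0 0 = 1.
Proof. by have := expand_XZ xi 0 1 0; rewrite mul1r. Qed.

Lemma varZ_not_dvd : ~ (exists Q, 'X_iZ = G * Q).
Proof.
case=> Q /(congr1 (meval ptO)); rewrite mevalXU /ptO eqxx rmorphM /= GO mul0r.
by move/eqP; rewrite oner_eq0.
Qed.

Lemma DeltaNO_triangle : seteq2 (DeltaNO G xi) (triangle (1 / d%:R) 0 d%:R).
Proof.
apply: closure_conv_hull_triangle => //; first by rewrite divr_gt0.
- move=> _ [k [F [m [o [k0 [hF [nzF [nuF ->]]]]]]]].
  have [le _] := nu_at_bound d_gt0 hG irrG GO dGO xi0 Gxi hF nzF nuF.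
  have {}le := bound_real k0 le.
  apply/triangleP; rewrite ?divr_gt0 //=.
  have x0 : 0 <= m%:R / k%:R :> RR by rewrite divr_ge0.
  have y0 : 0 <= o%:R / k%:R :> RR by rewrite divr_ge0.
  move: (o%:R / k%:R) (m%:R / k%:R) x0 y0 le => y x x0 y0 le.
  have dV0 : 0 <= 1 / d%:R :> RR by rewrite divr_ge0.
  split=> //; first by rewrite mul0r mulr_ge0 // ltW.
  have := ler_wpM2l dV0 le; rewrite mulrDr.
  rewrite (_ : 1 / d%:R * (d%:R ^+ 2 * x) = d%:R * x); last by field.
  by rewrite mul0r subr0 addrC.
(* The form Z is nonzero at [O], so its flag valuation is (0, 0). *)
- apply: closure2_sub; exists 1%N, 'X_iZ, 0%N, 0%N.
  rewrite !mul0r; do !split=> //.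
  + exact: dhomog_var.
  + by rewrite -msize_poly_eq0 msizeX.
  + exists 'X_iZ; rewrite mul1r; split=> //; split; first exact: varZ_not_dvd.
    by split; rewrite // expand_varZ oner_neq0.
(* [G] has cofactor 1 and degree [d], which gives (1/d, 0). *)
- apply: closure2_sub; exists d, G, 1%N, 0%N; rewrite mul0r.
  do !split=> //; first exact: irreducible_neq0 dGO.
  exists 1; rewrite expr1 mulr1; split=> //; split.
    case=> Q /(congr1 (meval ptO)); rewrite rmorphM /= rmorph1 GO mul0r.
    by move/eqP; rewrite oner_eq0.
  by split; rewrite // expand1 oner_neq0.
(* For (0, d), the index (o, m) of a corner form falls in the free corner, so m/k and o/k are within
   1/r and d/r of 0 and d; [d%:R + 1] covers both errors. *)
- move=> e e0; have [r r0 lte] := exists_small_quotient (d%:R + 1) e0.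
  have [F [hF nzF] F0] := corner_form xi d_gt0 r0.
  have [m [o nuF]] := nu_at_exists d_gt0 hG irrG GO dGO Gxi hF nzF.
  have [le nz] := nu_at_bound d_gt0 hG irrG GO dGO xi0 Gxi hF nzF nuF.
  have [ltm lto] := F0 _ _ le nz.
  have [/andP[m0 m1] o1 o2] := corner_estimate d_gt0 r0 ltm lto le.
  exists (m%:R / (d * r ^ 2)%:R, o%:R / (d * r ^ 2)%:R); split.
    exists (d * r ^ 2)%N, F, m, o; do !split=> //.
    by rewrite muln_gt0 d_gt0 expn_gt0 r0.
  rewrite /=; rewrite mulrDl in lte.
  have r1 : 0 <= 1 / r%:R :> RR by rewrite divr_ge0.
  have r2 : 0 <= d%:R / r%:R :> RR by rewrite divr_ge0.
  split; rewrite ltr_norml; apply/andP; split; lra.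
Qed.

Section Slope.
Variable s : rat.
Hypothesis s_ge : ((d ^ 2)%N)%:Q <= s.

Let ratr_value (i j : nat) : ratr (i%:Q + s * j%:Q) = i%:R + ratr s * j%:R :> RR.
Proof. by rewrite rmorphD rmorphM /= -!pmulrn !ratr_nat. Qed.

Let s_ge0 : 0 <= ratr s :> RR.
Proof. by rewrite ler0q (le_trans _ s_ge). Qed.

Lemma DeltaCs_triangle :
  seteq2 (DeltaCs xi s) (triangle d%:R (ratr s / d%:R) (1 / d%:R)).
Proof.
apply: closure_conv_hull_triangle => //; first by rewrite divr_gt0.
- move=> _ [k [F [i [j [k0 [hF [nzF [vF ->]]]]]]]].
  have le := vplus_at_bound d_gt0 hG irrG GO dGO xi0 Gxi s_ge hF nzF vF.
  have {}le := bound_real k0 le.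
  apply/triangleP; rewrite ?divr_gt0 //= ratr_value.
  have x0 : 0 <= i%:R / k%:R :> RR by rewrite divr_ge0.
  have y0 : 0 <= j%:R / k%:R :> RR by rewrite divr_ge0.
  rewrite mulrDl -[ratr s * _ / _]mulrA.
  move: (i%:R / k%:R) (j%:R / k%:R) x0 y0 le => x y x0 y0 le.
  split=> //.
  (* The side through (0, 0) and (s/d, 1/d) expresses i >= 0. *)
  + rewrite (_ : ratr s / d%:R * y = 1 / d%:R * (ratr s * y)); last by field.
    by rewrite ler_wpM2l ?divr_ge0 // lerDr.
  + have dV0 : 0 <= 1 / d%:R :> RR by rewrite divr_ge0.
    have := ler_wpM2l dV0 le; rewrite [1 / d%:R * d%:R]mulrC.
    by congr (_ <= _); field.
- apply: closure2_sub; exists 1%N, 'X_iZ, 0%N, 0%N.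
  rewrite ratr_value !mulr0 addr0 !mul0r; split=> //; split; first exact: dhomog_var.
  split; first by rewrite -msize_poly_eq0 msizeX.
  split=> //; split; first by rewrite expand_varZ oner_neq0.
  by split=> //; rewrite mulr0 addr0 addr_ge0 ?mulr_ge0 // (le_trans _ s_ge).
(* For (d, 0), the first coordinate i/k + s j/k of a corner form errs by at most d/r below and s/r
   above, the second by 1/r. *)
- move=> e e0; have [r r0 lte] := exists_small_quotient (d%:R + 1 + ratr s) e0.
  have [F [hF nzF] F0] := corner_form xi d_gt0 r0.
  have [i [j vF]] := vplus_at_exists d_gt0 hG irrG GO dGO xi0 Gxi s_ge hF nzF.
  have le := vplus_at_bound d_gt0 hG irrG GO dGO xi0 Gxi s_ge hF nzF vF.
  have [ltj lti] := F0 _ _ le (proj1 vF).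
  have [/andP[m0 m1] o1 o2] := corner_estimate d_gt0 r0 ltj lti le.
  exists (ratr (i%:Q + s * j%:Q) / (d * r ^ 2)%:R, j%:R / (d * r ^ 2)%:R); split.
    exists (d * r ^ 2)%N, F, i, j; split; last by do 3!split=> //.
    by rewrite muln_gt0 d_gt0 expn_gt0 r0.
  rewrite /= ratr_value mulrDl -[ratr s * _ / _]mulrA; rewrite !mulrDl in lte.
  have r1 : 0 <= 1 / r%:R :> RR by rewrite divr_ge0.
  have r2 : 0 <= d%:R / r%:R :> RR by rewrite divr_ge0.
  have s1 := ler_wpM2l s_ge0 m1.
  have s2 := mulr_ge0 s_ge0 m0.
  have s3 : ratr s * (1 / r%:R) = ratr s / r%:R :> RR by rewrite mul1r.
  by split; rewrite ltr_norml; apply/andP; split; lra.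
(* Row 0 of [G] vanishes and its entry at (0, 1) does not, so its valuation is (s, 1), and degree
   [d] gives the vertex (s/d, 1/d). *)
- apply: closure2_sub; exists d, G, 0%N, 1%N.
  rewrite ratr_value add0r mulr1; do 2!split=> //.
  split; first exact: irreducible_neq0 dGO.
  split=> //; split; first exact: expand_curve01.
  move=> i [|j] nz; first by rewrite Gxi eqxx in nz.
  split=> //; rewrite add0r mulr1 -!pmulrn.
  have : s <= s * j.+1%:R by rewrite ler_peMr ?(le_trans _ s_ge) // (ler_nat rat 1).
  by have : 0 <= i%:R :> rat by []; lra.
Qed.

(** The matrix sends (i + s j, j) to (j, i), so it matches the sides of the two triangles: i >= 0, j
    >= 0 and i + d^2 j <= d k in both. *)
Lemma DeltaNO_matimg :
  seteq2 (DeltaNO G xi) (matimg 0 1 1 (- ratr s) (DeltaCs xi s)).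
Proof.
have dV : 0 < 1 / d%:R :> RR by rewrite divr_gt0.
move=> p; split.
  move/DeltaNO_triangle/(triangleP _ _ dV dR)=> [y0 x0 le].
  (* The preimage of [p] under the matrix. *)
  exists (p.2 + ratr s * p.1, p.1); split; last first.
    by rewrite /=; case: p {y0 x0 le} => x y /=; congr (_, _); ring.
  apply/DeltaCs_triangle/triangleP => //=; split.
  - by move: x0; rewrite mul0r pmulr_rge0.
  - rewrite (_ : ratr s / d%:R * p.1 = 1 / d%:R * (ratr s * p.1)); last by field.
    by rewrite ler_wpM2l ?(ltW dV) // lerDr.
  - move: le; rewrite mul0r subr0 addrC [d%:R * (1 / _)]mulrC.
    by congr (_ <= _); field.
case=> q [/DeltaCs_triangle/(triangleP _ _ dR dV)[y0 x0 le] ->].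
apply/DeltaNO_triangle/triangleP => //=; split.
- rewrite -(pmulr_rge0 _ dV) [X in 0 <= X](_ : _ = 1 / d%:R * q.1 - ratr s / d%:R * q.2).
    by rewrite subr_ge0.
  by field.
- by rewrite mul0r mul0r add0r mul1r mulr_ge0 // ltW.
- move: le; rewrite [d%:R * (1 / _)]mulrC.
  by congr (_ <= _); field.
Qed.

End Slope.
End Bodies.

Theorem theorem5p11 (d : nat) (G : {mpoly CC[3]}) (xi : ps) :
  (0 < d)%N -> homog3 d G -> mirreducible G ->
  G.@[ptO] = 0 ->
  (mderiv iX G).@[ptO] = 0 -> (mderiv iY G).@[ptO] != 0 ->
  xi 0%N = 0 -> xi 1%N = 0 -> (forall i : nat, expand xi G i 0 = 0) ->
  forall s : rat, ((d ^ 2)%N)%:Q <= s ->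
    seteq2 (DeltaCs xi s) (triangle d%:R (ratr s / d%:R) (1 / d%:R)) /\
    seteq2 (DeltaNO G xi) (triangle (1 / d%:R) 0 d%:R) /\
    seteq2 (DeltaNO G xi) (matimg 0 1 1 (- ratr s) (DeltaCs xi s)).
Proof.
move=> d_gt0 hG irrG GO _ dGO xi0 _ Gxi s s_ge; split.
  exact (DeltaCs_triangle d_gt0 hG irrG GO dGO xi0 Gxi s_ge).
split; first exact (DeltaNO_triangle d_gt0 hG irrG GO dGO xi0 Gxi).
exact (DeltaNO_matimg d_gt0 hG irrG GO dGO xi0 Gxi s_ge).
Qed.
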